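(* Let $R$ be a finite (associative, with $1\neq 0$, not necessarily commutative) local ring with Jacobson radical $J$. Then the vertex set of the distant graph $G(R,\Delta)$ can be partitioned into $|J|$ pairwise vertex-disjoint maximal cliques, and $\omega\bigl(G(R,\Delta)\bigr)=|R/J|+1$.
   Context: All rings are finite, associative, with $1\ne 0$. A pair $(a,b)\in R^2$ is admissible if it is the first row of some matrix in $GL_2(R)$. The projective line $\mathbb{P}(R)$ is the set of left cyclic submodules $R(a,b)=\{(\alpha a,\alpha b):\alpha\in R\}$ of the free left module $R^2$ generated by admissible pairs $(a,b)$; equivalently, it is the orbit of $R(1,0)$ under the right action of $GL_2(R)$. Two points $R(a,b),R(c,d)\in\mathbb{P}(R)$ are distant, written $R(a,b)\,\Delta\, R(c,d)$, if $\begin{pmatrix} a&b\\ c&d\end{pmatrix}\in GL_2(R)$ (this does not depend on the choice of admissible generators). The distant graph $G(R,\Delta)$ is the undirected simple graph with vertex set $\mathbb{P}(R)$ in which two vertices are joined by an edge if and only if they are distant. A clique is a set of pairwise adjacent vertices. Convention: maximal cliques are taken to be maximum cliques, i.e. ''maximal clique'' of a graph $G$ means a clique with the largest possible number of vertices, and this number is denoted by $\omega(G)$. *)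

(* Defs.v *)
From HB Require Import structures.
From mathcomp Require Import all_boot all_algebra.

Set Implicit Arguments.
Unset Strict Implicit.
Unset Printing Implicit Defensive.

Import GRing.Theory.
Local Open Scope ring_scope.

Section Cliques.
Variables (T : finType) (V : {set T}) (e : rel T).

Definition clique (C : {set T}) : bool :=
  (C \subset V) && [forall x in C, forall y in C, (x != y) ==> e x y].

Definition clique_number : nat := \max_(C : {set T} | clique C) #|C|.

(* Maximal in cardinality, not merely for inclusion. *)
Definition maximal_clique (C : {set T}) : bool :=
  clique C && (#|C| == clique_number).
End Cliques.

Section Ideals.
Variable R : finNzRingType.

Definition proper_left_ideal (I : {set R}) : bool :=
  [&& 0 \in I, 1 \notin I &
      [forall a, forall x in I, forall y in I, a * x + y \in I]].

Lemma proper_left_idealP (I : {set R}) :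
  reflect (idealr_closed I) (proper_left_ideal I).
Proof.
apply: (iffP and3P) => -[I0 I1 IS]; split=> //.
  by move=> a x y xI yI; move/forallP/(_ a)/forall_inP/(_ x xI): IS =>
     /forall_inP; apply.
apply/forallP=> a; apply/forall_inP=> x xI; apply/forall_inP=> y yI.
exact: IS.
Qed.

Definition maximal_left_ideal (I : {set R}) : bool :=
  maxset proper_left_ideal I.

Definition jacobson_radical : {set R} :=
  \bigcap_(I : {set R} | maximal_left_ideal I) I.

Definition is_local : Prop := exists! M : {set R}, maximal_left_ideal M.

(* The underlying set of R / I: the additive cosets x + I. *)
Definition cosets (I : {set R}) : {set {set R}} :=
  [set [set x + y | y in I] | x : R].
End Ideals.

Arguments jacobson_radical R : clear implicits.
Arguments is_local R : clear implicits.

Section ProjectiveLine.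
Variable R : finNzRingType.
Implicit Types (u v : 'rV[R]_2) (p q : {set 'rV[R]_2}).

(* The library's unitmx and {'GL_2[R]} require R to be commutative. *)
Definition GL2 (A : 'M[R]_2) : bool :=
  [exists B : 'M[R]_2, (A *m B == 1%:M) && (B *m A == 1%:M)].

Definition admissible u : bool :=
  [exists A : 'M[R]_2, GL2 A && (row 0 A == u)].

Definition cyclic_submodule u : {set 'rV[R]_2} := [set a *: u | a : R].

Definition projective_line : {set {set 'rV[R]_2}} :=
  [set cyclic_submodule u | u in admissible].

(* The choice of the admissible generators is immaterial: see distantE. *)
Definition distant : rel {set 'rV[R]_2} := fun p q =>
  [exists u : 'rV[R]_2, exists v : 'rV[R]_2,
    [&& admissible u, admissible v,
        p == cyclic_submodule u, q == cyclic_submodule v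
      & GL2 (col_mx u v)]].

Lemma admissible_cancel u (a : R) : admissible u -> a *: u = u -> a = 1.
Proof.
case/existsP=> A /andP[/existsP[B /andP[/eqP AB _]] /eqP <-] aA.
have: (a *: row 0 A *m B) 0 0 = (row 0 A *m B) 0 0 by rewrite aA.
by rewrite -scalemxAl -!row_mul AB !mxE eqxx mulr1.
Qed.

Lemma cyclic_submodule_unit u v : admissible u -> admissible v ->
  cyclic_submodule u = cyclic_submodule v ->
  exists a b : R, [/\ u = a *: v, a * b = 1 & b * a = 1].
Proof.
move=> au av uv.
have: u \in cyclic_submodule v.
  by rewrite -uv; apply/imsetP; exists 1; rewrite ?scale1r.
have: v \in cyclic_submodule u.
  by rewrite uv; apply/imsetP; exists 1; rewrite ?scale1r.
case/imsetP=> b _ vE /imsetP[a _ uE]; exists a, b; split=> //.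
  by apply: (admissible_cancel au); rewrite -scalerA -vE -uE.
by apply: (admissible_cancel av); rewrite -scalerA -uE -vE.
Qed.

Lemma distantE u v : admissible u -> admissible v ->
  distant (cyclic_submodule u) (cyclic_submodule v) = GL2 (col_mx u v).
Proof.
move=> au av; apply/idP/idP => [|G]; last first.
  by apply/existsP; exists u; apply/existsP; exists v; rewrite au av !eqxx.
case/existsP=> u' /existsP[v' /and5P[au' av' /eqP uu' /eqP vv']].
have [a [b [-> ab ba]]] := cyclic_submodule_unit au au' uu'.
have [c [d [-> cd dc]]] := cyclic_submodule_unit av av' vv'.
case/existsP=> B /andP[/eqP AB /eqP BA].
pose D (x y : R) : 'M[R]_(1 + 1) := block_mx x%:M 0 0 y%:M.
have DM x y x' y' : D x y *m D x' y' = D (x * x') (y * y').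
  by rewrite mulmx_block !mulmx0 !mul0mx !addr0 !add0r -!scalar_mxM.
have D1 : D 1 1 = 1%:M by rewrite [RHS]scalar_mx_block.
have -> : col_mx (a *: u') (c *: v') = D a c *m col_mx u' v'.
  by rewrite mul_block_col !mul0mx addr0 add0r !mul_scalar_mx.
apply/existsP; exists (B *m D b d); apply/andP; split; apply/eqP.
  by rewrite -mulmxA (mulmxA (col_mx _ _)) AB mul1mx DM ab cd D1.
by rewrite -mulmxA (mulmxA (D b d)) DM ba dc D1 mul1mx.
Qed.

Lemma distant_sym : symmetric distant.
Proof.
suff S p q : distant p q -> distant q p by move=> p q; apply/idP/idP; apply: S.
case/existsP=> u /existsP[v /and5P[au av /eqP -> /eqP ->]].
rewrite distantE // => /existsP[B /andP[/eqP AB /eqP BA]].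
pose P : 'M[R]_(1 + 1) := block_mx 0 1%:M 1%:M 0.
have PP : P *m P = 1%:M.
  by rewrite mulmx_block !mulmx0 !mul0mx !mulmx1 !addr0 !add0r -scalar_mx_block.
have -> : col_mx v u = P *m col_mx u v.
  by rewrite mul_block_col !mul0mx !mul1mx addr0 add0r.
apply/existsP; exists (B *m P); apply/andP; split; apply/eqP.
  by rewrite -mulmxA (mulmxA (col_mx _ _)) AB mul1mx PP.
by rewrite -mulmxA (mulmxA P) PP mul1mx.
Qed.

Lemma distant_irr : irreflexive distant.
Proof.
move=> p; apply/negbTE/negP => /existsP[u /existsP[v /and5P[au av /eqP -> /eqP uv]]].
have [a [b [-> ab ba]]] := cyclic_submodule_unit au av uv.
case/existsP=> B /andP[/eqP AB _].
pose w : 'rV[R]_(1 + 1) := row_mx 1%:M (- a%:M).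
have wM : w *m col_mx (a *: v) v = 0.
  by rewrite mul_row_col mulNmx mul1mx mul_scalar_mx subrr.
have /rowP/(_ 0): w = 0 by rewrite -[w]mulmx1 -AB mulmxA wM mul0mx.
rewrite !mxE; case: splitP => // k _; rewrite ord1 !mxE eqxx => /eqP.
by rewrite oner_eq0.
Qed.

End ProjectiveLine.

Arguments projective_line R : clear implicits.
Arguments distant R : clear implicits.

(* Main.v *)
Require Import Defs.
From mathcomp Require Import all_boot all_algebra.

(** Over a finite local ring [R] with radical [J] the distant graph is a
    complete multipartite graph with [#|R / J| + 1] parts of [#|J|] points
    each; both claims are then purely combinatorial
    ([multipartite_clique_partition], [multipartite_clique_number]).

    Indeed every element outside [J] is invertible, and an admissible pair
    cannot have both entries in [J] ([admissible_coord]). Hence the points are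
    the [R(1, x)] with [x] in [R] and the [R(y, 1)] with [y] in [J]
    ([projective_lineE]). Row reduction shows that [R(1, x)] and [R(1, x')]
    are distant exactly when [x - x'] is invertible, that is, when [x] and
    [x'] lie in different cosets of [J]; that [R(1, x)] and [R(y, 1)] are
    always distant, because [1 - x y] is invertible; and that two points
    [R(y, 1)] and [R(y', 1)] never are, because [y - y'] is in [J]. So the
    parts are the cosets of [J] together with one part at infinity
    ([distant_point]). Writing [x = s + j], with [s] the chosen representative
    of the coset of [x], labels each point by its part and an element [j] of
    [J], and [R(y, 1)] is labelled by [y]; the points labelled by a fixed [j]
    meet every part exactly once and form one of the [#|J|] cliques.

    As [R] is finite, it is enough to test invertibility by one-sided
    cancellation, both for elements of [R] and for matrices. *)

Set Implicit Arguments.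
Unset Strict Implicit.
Unset Printing Implicit Defensive.

Import GRing.Theory.
Local Open Scope ring_scope.

(** * Complete multipartite graphs with parts of equal size *)

Section Multipartite.
Variables (T I K : finType) (e : rel T) (A : {set I}) (B : {set K}).
Variable f : I -> K -> T.
Hypothesis f_inj : forall i i' k k', i \in A -> i' \in A -> k \in B ->
  k' \in B -> f i k = f i' k' -> i = i' /\ k = k'.
Hypothesis f_adj : forall i i' k k', i \in A -> i' \in A -> k \in B ->
  k' \in B -> e (f i k) (f i' k') = (i != i').

Let V : {set T} := [set f i k | i in A, k in B].
Let section k : {set T} := [set f i k | i in A].

Lemma clique_section k : k \in B -> clique V e (section k).
Proof.
move=> kB; apply/andP; split.
  by apply/subsetP=> _ /imsetP[i iA ->]; apply: imset2_f.
apply/forall_inP=> _ /imsetP[i iA ->]; apply/forall_inP=> _ /imsetP[i' iA' ->].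
by rewrite f_adj //; apply/implyP; apply: contraNneq => ->.
Qed.

Lemma card_section k : k \in B -> #|section k| = #|A|.
Proof.
by move=> kB; apply: card_in_imset => i i' iA iA' /(f_inj iA iA' kB kB)[].
Qed.

(** Two vertices of a clique lie in different parts, so that sending a vertex to
    its part is injective on the clique. *)
Lemma card_clique_le C : clique V e C -> (#|C| <= #|A|)%N.
Proof.
case/andP=> /subsetP CV /forall_inP Ce.
have [->|[x0 x0C]] := set_0Vmem C; first by rewrite cards0.
have /imset2P[i0 k0 i0A k0B _] := CV _ x0C.
pose part x := odflt i0 [pick i in A | [exists k in B, x == f i k]].
have partP x : x \in C ->
    part x \in A /\ exists2 k, k \in B & x = f (part x) k.
  move=> /CV/imset2P[i k iA kB xE]; rewrite /part; case: pickP => [j|/(_ i)].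
    by case/andP=> jA /exists_inP[k' k'B /eqP ->]; split=> //; exists k'.
  by rewrite /= iA => /negbT/exists_inP[]; exists k => //; apply/eqP.
have part_inj : {in C &, injective part}.
  move=> x y xC yC pxy; apply/eqP/negPn/negP => nxy.
  have := forall_inP (Ce x xC) y yC; rewrite nxy /=.
  have [pA [k kB ->]] := partP x xC; have [qA [k' kB' ->]] := partP y yC.
  by rewrite f_adj // pxy eqxx.
rewrite -(card_in_imset part_inj); apply/subset_leq_card/subsetP.
by move=> _ /imsetP[x /partP[pA _] ->].
Qed.

Lemma multipartite_clique_number k0 : k0 \in B -> clique_number V e = #|A|.
Proof.
move=> k0B; apply/eqP; rewrite eqn_leq; apply/andP; split.
  by apply/bigmax_leqP=> C; apply: card_clique_le.
rewrite -(card_section k0B); apply: (leq_bigmax_cond _ (clique_section k0B)).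
Qed.

Lemma multipartite_clique_partition i0 k0 : i0 \in A -> k0 \in B ->
  exists P : {set {set T}},
    [/\ partition P V, #|P| = #|B|
      & forall C, C \in P -> maximal_clique V e C].
Proof.
move=> i0A k0B.
have section_eq k k' x : k \in B -> k' \in B -> x \in section k ->
    x \in section k' -> k = k'.
  move=> kB kB' /imsetP[i iA ->] /imsetP[i' iA' E].
  by have [] := f_inj iA iA' kB kB' E.
exists (section @: B); split.
- apply/and3P; split.
  + apply/eqP/setP=> x; apply/bigcupP/imset2P.
      by case=> _ /imsetP[k kB ->] /imsetP[i iA ->]; exists i k.
    case=> i k iA kB ->; exists (section k); first exact: imset_f.
    exact: (imset_f (f^~ k)).
  + apply/trivIsetP=> _ _ /imsetP[k kB ->] /imsetP[k' kB' ->].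
    apply: contraR => /pred0Pn[x /andP[xk xk']].
    by rewrite (section_eq k k' x).
  + apply/negP=> /imsetP[k kB E].
    by have := imset_f (f^~ k) i0A; rewrite -[_ @: _]E inE.
- apply: card_in_imset => k k' kB kB' E.
  have x_in : f i0 k \in section k by apply: (imset_f (f^~ k)).
  by apply: (section_eq k k' (f i0 k)); rewrite -?E.
- move=> _ /imsetP[k kB ->]; rewrite /maximal_clique clique_section //=.
  by rewrite card_section // (multipartite_clique_number k0B).
Qed.

End Multipartite.

(** * One-sided invertibility in finite rings *)

Section FiniteRing.
Variable R : finNzRingType.
Implicit Types (a x y : R).

(** Right multiplication by [x] is an injective, hence surjective, map of the
    finite set [R]. *)
Lemma left_inverse_of_cancel x :
  (forall a, a * x = 0 -> a = 0) -> exists y, y * x = 1.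
Proof.
move=> x_reg; have x_inj : injective (fun a => a * x).
  move=> a b /eqP; rewrite -subr_eq0 -mulrBl => /eqP/x_reg/eqP.
  by rewrite subr_eq0 => /eqP.
by have [g _ gK] := injF_bij x_inj; exists (g 1).
Qed.

(** Since [y x = 1], right multiplication by [y] is injective; so [y] has a left
    inverse [z], and [z = z (y x) = x]. *)
Lemma left_inverse_is_right x y : y * x = 1 -> x * y = 1.
Proof.
move=> yx; have [a ay|z zy] := @left_inverse_of_cancel y.
  by rewrite -[a]mulr1 -yx mulrA ay mul0r.
by rewrite -[x]mul1r -zy -(mulrA z) yx mulr1.
Qed.

End FiniteRing.

Lemma row_mul_col_mx (R : finNzRingType) (w : 'rV[R]_(1 + 1)) (u v : 'rV[R]_2) :
  w *m col_mx u v = lsubmx w 0 0 *: u + rsubmx w 0 0 *: v.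
Proof. by rewrite -!mul_scalar_mx -!mx11_scalar -mul_row_col hsubmxK. Qed.

(** The matrix ring [M_2(R)] is itself finite, so that a matrix whose rows are
    left linearly independent is invertible. *)
Lemma GL2_col_mxP (R : finNzRingType) (u v : 'rV[R]_2) :
  GL2 (col_mx u v) <->
  (forall a b : R, a *: u + b *: v = 0 -> a = 0 /\ b = 0).
Proof.
split=> [/existsP[B /andP[/eqP AB _]] a b uv0|uv_free].
  pose w : 'rV[R]_(1 + 1) := row_mx a%:M b%:M.
  have w0 : w = 0.
    rewrite -[w]mulmx1 -AB mulmxA row_mul_col_mx row_mxKl row_mxKr.
    by rewrite !mxE !mulr1n uv0 mul0mx.
  have := congr1 (fun w => (lsubmx w 0 0, rsubmx w 0 0)) w0.
  by rewrite row_mxKl row_mxKr !mxE !mulr1n => -[].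
pose A : 'M[R]_2 := col_mx u v.
have [B BA|B BA] := @left_inverse_of_cancel 'M[R]_2 A.
  apply/row_matrixP=> i; rewrite row0.
  have := congr1 (row i) BA; rewrite row_mul row0.
  rewrite row_mul_col_mx => /uv_free[l0 r0].
  rewrite -[row i B](@hsubmxK _ 1 1 1).
  rewrite [lsubmx _]mx11_scalar [rsubmx _]mx11_scalar.
  by rewrite l0 r0 raddf0 row_mx0.
apply/existsP; exists B; apply/andP; split; apply/eqP => //.
exact: left_inverse_is_right.
Qed.

(** * Finite local rings *)

Section LocalRing.
Variable R : finNzRingType.
Implicit Types (a b x y : R).
Hypothesis R_local : is_local R.
Local Notation J := (jacobson_radical R).

Lemma radical_maximal : maximal_left_ideal J.
Proof.
case: R_local => M [maxM uniqM]; suff -> : J = M by [].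
rewrite /jacobson_radical (big_pred1 M) // => I /=.
by apply/idP/eqP => [/uniqM->|->].
Qed.

Lemma radical_closed : idealr_closed J.
Proof. by apply/proper_left_idealP; have /maxsetP[] := radical_maximal. Qed.

Lemma radical0 : 0 \in J.
Proof. by have [] := radical_closed. Qed.

Lemma radical1 : 1 \notin J.
Proof. by have [] := radical_closed. Qed.

Lemma radicalMl a x : x \in J -> a * x \in J.
Proof.
move=> xJ; have [J0 _ JS] := radical_closed.
by have := JS a x 0 xJ J0; rewrite addr0.
Qed.

Lemma radicalD x y : x \in J -> y \in J -> x + y \in J.
Proof.
move=> xJ yJ; have [_ _ JS] := radical_closed.
by have := JS 1 x y xJ yJ; rewrite mul1r.
Qed.

Lemma radicalN x : x \in J -> - x \in J.
Proof. by move=> /(radicalMl (-1)); rewrite mulN1r. Qed.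

Lemma radicalB x y : x \in J -> y \in J -> x - y \in J.
Proof. by move=> xJ /radicalN; apply: radicalD. Qed.

(** Otherwise [R x] would be a proper left ideal, contained in the only
    maximal one. *)
Lemma notin_radical_inverse x :
  x \notin J -> exists y, y * x = 1 /\ x * y = 1.
Proof.
move=> xJ; pose I := [set a * x | a : R].
have [/imsetP[y _ /esym yx]|I1] := boolP (1 \in I).
  by exists y; rewrite (left_inverse_is_right yx).
have propI : proper_left_ideal I.
  apply/proper_left_idealP; split=> //.
    by apply/imsetP; exists 0; rewrite ?mul0r.
  move=> a _ _ /imsetP[b _ ->] /imsetP[c _ ->].
  by apply/imsetP; exists (a * b + c); rewrite // mulrDl mulrA.
have [M maxM IM] := maxset_exists propI.
have MJ : M = J.
  case: R_local => N [_ uniqN].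
  by rewrite -(uniqN _ maxM) (uniqN _ radical_maximal).
case/negP: xJ; rewrite -MJ; apply: (subsetP IM).
by apply/imsetP; exists 1; rewrite ?mul1r.
Qed.

Lemma notin_radical_cancel x :
  x \notin J <-> (forall a, a * x = 0 -> a = 0).
Proof.
split=> [/notin_radical_inverse[y [_ xy]] a ax|/left_inverse_of_cancel[y yx]].
  by rewrite -[a]mulr1 -xy mulrA ax mul0r.
by apply: contra radical1 => /(radicalMl y); rewrite yx.
Qed.

(** If [x r] were invertible with [x] in [J], then [x] would have a right
    inverse, hence a left inverse, and [1] would lie in the left ideal [J]. *)
Lemma radicalMr x r : x \in J -> x * r \in J.
Proof.
move=> xJ; apply: contraT => /notin_radical_inverse[y [_]].
rewrite -mulrA => /left_inverse_is_right yx.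
by have := radicalMl (r * y) xJ; rewrite yx (negPf radical1).
Qed.

Lemma one_sub_radical x : x \in J -> 1 - x \notin J.
Proof.
by move=> xJ; apply: contra radical1 => /radicalD/(_ xJ); rewrite subrK.
Qed.

(** * Representatives of the cosets of the radical *)

Definition coset_repr (X : {set R}) : R := odflt 0 [pick x in X].

Lemma coset_reprP X x : X \in cosets J -> (x \in X) = (x - coset_repr X \in J).
Proof.
case/imsetP=> c _ XE.
have memX z : (z \in X) = (z - c \in J).
  rewrite XE; apply/imsetP/idP => [[j jJ ->]|zJ]; first by rewrite addrC addKr.
  by exists (z - c); rewrite // addrC subrK.
rewrite memX /coset_repr; case: pickP => [r|/(_ c)]; last first.
  by rewrite memX subrr radical0.
rewrite memX /= => rJ; apply/idP/idP => [xJ|xJ].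
  by rewrite -(subrKA c) -(opprB r c) radicalB.
by rewrite -(subrKA r) radicalD.
Qed.

Lemma coset_repr_inj X Y : X \in cosets J -> Y \in cosets J ->
  coset_repr X - coset_repr Y \in J -> X = Y.
Proof.
move=> cX cY XY; apply/setP=> x.
rewrite (coset_reprP x cX) (coset_reprP x cY); apply/idP/idP => xJ.
  by rewrite -(subrKA (coset_repr X)) radicalD.
by rewrite -(subrKA (coset_repr Y)) radicalD // -opprB radicalN.
Qed.

Lemma coset_repr_cover x :
  exists2 X, X \in cosets J & x - coset_repr X \in J.
Proof.
have cX : [set x + y | y in J] \in cosets J by apply: imset_f.
exists [set x + y | y in J]; rewrite // -coset_reprP //.
by apply/imsetP; exists 0; rewrite ?radical0 ?addr0.
Qed.

(** * The points of the projective line *)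

Definition row2 a b : 'rV[R]_2 := \row_(i < 2) if i == 0 then a else b.

Lemma row2E (u : 'rV[R]_2) : u = row2 (u 0 0) (u 0 1).
Proof.
apply/rowP=> -[[|[|]] //= lti]; rewrite !mxE.
  by congr (u _ _); apply/val_inj.
by congr (u _ _); apply/val_inj.
Qed.

Lemma row2_inj a b c d : row2 a b = row2 c d -> a = c /\ b = d.
Proof. by move/rowP=> E; have := (E 0, E 1); rewrite !mxE /= => -[]. Qed.

Lemma scale_row2 r a b : r *: row2 a b = row2 (r * a) (r * b).
Proof. by apply/rowP=> i; rewrite !mxE; case: ifP. Qed.

Lemma add_row2 a b c d : row2 a b + row2 c d = row2 (a + c) (b + d).
Proof. by apply/rowP=> i; rewrite !mxE; case: ifP. Qed.

Lemma row20 : row2 0 0 = 0.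
Proof. by apply/rowP=> i; rewrite !mxE; case: ifP. Qed.

Lemma GL2_row2P a b c d :
  GL2 (col_mx (row2 a b) (row2 c d)) <->
  (forall r s, r * a + s * c = 0 -> r * b + s * d = 0 -> r = 0 /\ s = 0).
Proof.
split=> [/GL2_col_mxP|] free; last apply/GL2_col_mxP; move=> r s.
  by move=> E1 E2; apply: free; rewrite !scale_row2 add_row2 E1 E2 row20.
by rewrite !scale_row2 add_row2 -row20 => /row2_inj[]; apply: free.
Qed.

Lemma GL2_admissible (u v : 'rV[R]_2) : GL2 (col_mx u v) -> admissible u.
Proof.
move=> G; apply/existsP; exists (col_mx u v); rewrite G /=.
have <- : @lshift 1 1 0 = 0 by apply: val_inj.
by rewrite (@rowKu _ 1 1) row_id.
Qed.

Lemma admissible_affine x : admissible (row2 1 x).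
Proof.
apply: (@GL2_admissible _ (row2 0 1)); apply/GL2_row2P => r s.
by rewrite mulr1 mulr0 addr0 => ->; rewrite mul0r add0r mulr1.
Qed.

Lemma admissible_infinity y : admissible (row2 y 1).
Proof.
apply: (@GL2_admissible _ (row2 1 0)); apply/GL2_row2P => r s.
by rewrite !mulr1 mulr0 addr0 => + r0; rewrite r0 mul0r add0r.
Qed.

(** The pair has a right inverse, the first column of the inverse matrix, and
    [J] is a right ideal that does not contain [1]. *)
Lemma admissible_coord a b :
  admissible (row2 a b) -> (a \notin J) || (b \notin J).
Proof.
case/existsP=> A /andP[/existsP[B /andP[/eqP AB _]] /eqP rA].
rewrite -negb_and; apply: contra radical1 => /andP[aJ bJ].
have : (row2 a b *m B) 0 0 = 1 by rewrite -rA -row_mul AB !mxE.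
rewrite mxE big_ord_recl big_ord1 !mxE /= => <-.
by apply: radicalD; apply: radicalMr.
Qed.

Lemma cyclic_submodule_scale (r s : R) (u : 'rV[R]_2) :
  s * r = 1 -> cyclic_submodule (r *: u) = cyclic_submodule u.
Proof.
move=> sr; apply/setP=> w; apply/imsetP/imsetP => -[a _ ->].
  by exists (a * r); rewrite ?scalerA.
by exists (a * s); rewrite // scalerA -mulrA sr mulr1.
Qed.

(** [Some X] with [X] a coset of [J] names the part of the points [R(1, x)] with
    [x] in [X]; [None] names the part at infinity. *)
Definition part_names : {set option {set R}} :=
  None |: [set Some X | X in cosets J].

Definition point (o : option {set R}) (j : R) : {set 'rV[R]_2} :=
  cyclic_submodule
    (if o is Some X then row2 1 (coset_repr X + j) else row2 j 1).

Lemma part_nameP o : o \in part_names ->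
  if o is Some X then X \in cosets J else true.
Proof.
by case: o => // X; rewrite !inE /= => /imsetP[Y cY [->]].
Qed.

Lemma card_part_names : #|part_names| = (#|cosets J| + 1)%N.
Proof.
rewrite cardsU1 card_imset => [|X Y []//]; rewrite addnC.
by case: imsetP => // -[].
Qed.

(** A pair with an invertible entry can be normalised to have that entry equal
    to [1]; the first entry is preferred, so that the pairs [(y, 1)] which
    remain have [y] in [J]. *)
Lemma projective_lineE :
  projective_line R = [set point o j | o in part_names, j in J].
Proof.
apply/setP=> p; apply/imsetP/imset2P; last first.
  case=> -[X|] j _ _ ->.
    by exists (row2 1 (coset_repr X + j)); [apply: admissible_affine|].
  by exists (row2 j 1); [apply: admissible_infinity|].
case=> u; rewrite [u]row2E; move: (u 0 0) (u 0 1) => a b ab ->{p u}.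
have [aJ|/notin_radical_inverse[c [ca ac]]] := boolP (a \in J).
  have /notin_radical_inverse[c [cb bc]] : b \notin J.
    by have := admissible_coord ab; rewrite aJ.
  exists None (c * a); rewrite ?inE ?radicalMl //= /point.
  by rewrite -(cyclic_submodule_scale _ bc) scale_row2 cb.
have [X cX XJ] := coset_repr_cover (c * b).
exists (Some X) (c * b - coset_repr X); rewrite ?inE ?imset_f //= /point.
by rewrite addrC subrK -(cyclic_submodule_scale _ ac) scale_row2 ca.
Qed.

(** Eliminating, [r (1, x) + s (1, x') = 0] means [s = - r] and
    [r (x - x') = 0]. *)
Lemma distant_affine x x' :
  distant R (cyclic_submodule (row2 1 x)) (cyclic_submodule (row2 1 x')) =
  (x - x' \notin J).
Proof.
rewrite distantE ?admissible_affine //.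
apply/idP/idP => [/GL2_row2P free|/notin_radical_cancel reg].
  apply/notin_radical_cancel=> a ax; have [] // := free a (- a).
    by rewrite !mulr1 subrr.
  by rewrite mulNr -mulrBr.
apply/GL2_row2P=> r s; rewrite !mulr1 => /eqP.
rewrite addrC addr_eq0 => /eqP ->.
by rewrite mulNr -mulrBr => /reg ->; rewrite oppr0.
Qed.

(** Here [r (1, x) + s (y, 1) = 0] means [s = - r x] and [r (1 - x y) = 0]. *)
Lemma distant_affine_infinity x y : y \in J ->
  distant R (cyclic_submodule (row2 1 x)) (cyclic_submodule (row2 y 1)).
Proof.
move=> yJ; rewrite distantE ?admissible_affine ?admissible_infinity //.
apply/GL2_row2P=> r s; rewrite !mulr1 => rE /eqP.
rewrite addrC addr_eq0 => /eqP sE; move: rE; rewrite sE => rE.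
have -> : r = 0.
  move: (one_sub_radical (radicalMl x yJ)) => /notin_radical_cancel; apply.
  by rewrite mulrBr mulr1 mulrA -mulNr.
by rewrite mul0r oppr0.
Qed.

Lemma distant_infinity y y' : y \in J -> y' \in J ->
  ~~ distant R (cyclic_submodule (row2 y 1)) (cyclic_submodule (row2 y' 1)).
Proof.
move=> yJ y'J; rewrite distantE ?admissible_infinity //.
apply/negP=> /GL2_row2P free; have := radicalB yJ y'J; apply/negP.
apply/notin_radical_cancel=> a ay; have [] // := free a (- a).
  by rewrite mulNr -mulrBr.
by rewrite !mulr1 subrr.
Qed.

Lemma distant_point o o' j j' : o \in part_names -> o' \in part_names ->
  j \in J -> j' \in J -> distant R (point o j) (point o' j') = (o != o').
Proof.
case: o o' => [X|] [X'|] /part_nameP cX /part_nameP cX' jJ j'J; rewrite /point.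
- rewrite distant_affine opprD addrACA; congr (~~ _).
  apply/idP/eqP => [|[->]]; last by rewrite subrr add0r radicalB.
  move=> /radicalB/(_ (radicalB jJ j'J)); rewrite addrK.
  by move=> /(coset_repr_inj cX cX') ->.
- by rewrite distant_affine_infinity.
- by rewrite distant_sym distant_affine_infinity.
- exact/negbTE/distant_infinity.
Qed.

(** Points with different part names differ because they are distant. *)
Lemma point_inj o o' j j' : o \in part_names -> o' \in part_names ->
  j \in J -> j' \in J -> point o j = point o' j' -> o = o' /\ j = j'.
Proof.
move=> oP o'P jJ j'J E.
have eqo : o = o'.
  apply/eqP/negPn; rewrite -(distant_point oP o'P jJ j'J) E.
  by rewrite distant_irr.
split=> //; move: E; rewrite -eqo /point; case: {eqo} o oP => [X|] _.
  case/(cyclic_submodule_unit (admissible_affine _) (admissible_affine _)).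
  move=> a [_ [+ _ _]]; rewrite scale_row2 mulr1 => /row2_inj[<- ].
  by rewrite mul1r => /addrI.
case/(cyclic_submodule_unit (admissible_infinity _) (admissible_infinity _)).
move=> a [_ [+ _ _]]; rewrite scale_row2 mulr1 => /row2_inj[+ a1].
by rewrite -a1 mul1r.
Qed.

End LocalRing.

Theorem theorem5 (R : finNzRingType) (hR : is_local R) :
  (exists P : {set {set {set 'rV[R]_2}}},
     [/\ partition P (projective_line R),
         #|P| = #|jacobson_radical R|
       & forall C : {set {set 'rV[R]_2}}, C \in P ->
           maximal_clique (projective_line R) (distant R) C]) /\
  clique_number (projective_line R) (distant R) =
    (#|cosets (jacobson_radical R)| + 1)%N.
Proof.
have J0 := radical0 hR; have infP : None \in part_names R by rewrite !inE.
rewrite (projective_lineE hR); split.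
  exact: (multipartite_clique_partition (point_inj hR) (distant_point hR)
    infP J0).
rewrite -card_part_names.
exact: (multipartite_clique_number (point_inj hR) (distant_point hR) J0).
Qed.
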